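(* Let $Y$ be a real Banach space. The following conditions are equivalent: 1) $Y$ has the approximate hyperplane sum property for $\ell_\infty^4$. 2) There are a $1$-norming subset $B\subset S_{Y^*}$ and a function $\rho$ on $(0,1)$ with $0<\rho(\varepsilon)<\varepsilon$ such that for every $0<\varepsilon<1$, every $(y_i)_{i\le4}\in M_Y^4$, every nonempty $A\subset\{1,2,3,4\}$ and every $y^*\in B$ satisfying $y^*(y_i)>1-\rho(\varepsilon)$ for each $i\in A$, there exists $(z_i)_{i\le 4}\in M_Y^4$ with $\|z_i-y_i\|<\varepsilon$ for every $i\le 4$ and $\|\sum_{i\in A}z_i\|=|A|$. 3) For every $0<\varepsilon<1$ there exists $0<\nu(\varepsilon)<\varepsilon$ such that for every $(y_i)_{i\le4}\in M_Y^4$ and each convex combination $\sum_{i=1}^4\alpha_iy_i$ satisfying $\bigl\|\sum_{i=1}^4\alpha_iy_i\bigr\|>1-\nu(\varepsilon)$, there exist a set $A\subset\{1,2,3,4\}$ and $(z_i)_{i\le4}\in M_Y^4$ such that (i) $\sum_{i\in A}\alpha_i>1-\varepsilon$; (ii) $\|z_i-y_i\|<\varepsilon$ for each $i\le4$; (iii) $\bigl\|\sum_{i\in A}z_i\bigr\|=|A|$. Moreover, if condition 2) is satisfied with the function $\rho$, then condition 3) is satisfied with the function $\nu=\rho^2$ (that is, $\nu(\varepsilon)=(\rho(\varepsilon))^2$); and if condition 3) is satisfied with a function $\nu$, then $Y$ has the AHSp-$\ell_\infty^4$ with the function $\gamma(\varepsilon)=\nu\bigl(\frac{\varepsilon}{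4}\bigr)$.
   Context: All spaces are real. $B_Y$, $S_Y$, $Y^*$ denote the closed unit ball, unit sphere and topological dual of $Y$. A subset $B\subset B_{Y^*}$ is $1$-norming if $\|y\|=\sup\{|y^*(y)|:y^*\in B\}$ for each $y\in Y$. $M_Y^4=\{(y_i)_{i\le 4}\in (B_Y)^4: y_{i_1}-y_{i_2}+y_{i_3}\in B_Y \text{ for all } 1\le i_1<i_2<i_3\le 4\}$. $Y$ has the approximate hyperplane sum property for $\ell_\infty^4$ (AHSp-$\ell_\infty^4$) with the function $\gamma:(0,1)\to\mathbb{R}$, where $0<\gamma(\varepsilon)<\varepsilon$, if for every $0<\varepsilon<1$ and every $(y_i)_{i\le 4}\in M_Y^4$: whenever there exist a nonempty $A\subset\{1,2,3,4\}$ and $y^*\in S_{Y^*}$ such that $y^*(y_i)>1-\gamma(\varepsilon)$ for each $i\in A$, there exists $(z_i)_{i\le 4}\in M_Y^4$ with $\|z_i-y_i\|<\varepsilon$ for every $i\le 4$ and $\|\sum_{i\in A}z_i\|=|A|$. $Y$ has the AHSp-$\ell_\infty^4$ if it has it with some such $\gamma$. *)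

(* Defs.v *)
From mathcomp Require Export all_boot all_order all_algebra.
From mathcomp Require Export all_classical all_reals all_analysis.
Export Order.TTheory GRing.Theory Num.Theory.
Export numFieldNormedType.Exports.

Set Implicit Arguments.
Unset Strict Implicit.
Unset Printing Implicit Defensive.

Local Open Scope classical_set_scope.
Local Open Scope ring_scope.

Section BanachSpace.
Context {R : realType} (Y : completeNormedModType R).

Definition unit_ball : set Y := [set y | `|y| <= 1].

(* An element of the dual is a linear form that is continuous. On such forms
   the supremum below is over a nonempty bounded set; on discontinuous ones
   it is a junk value, so the ball and sphere require continuity. *)
Definition dual_norm (f : {linear Y -> R^o}) : R :=
  sup [set `|f y : R| | y in unit_ball].

Definition dual_ball : set {linear Y -> R^o} :=
  [set f : {linear Y -> R^o} | continuous f /\ dual_norm f <= 1].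

Definition dual_sphere : set {linear Y -> R^o} :=
  [set f : {linear Y -> R^o} | continuous f /\ dual_norm f = 1].

(* [sup set0 = 0], so the empty set is 1-norming exactly when Y is the zero
   space, whose dual sphere is empty. *)
Definition one_norming (B : set {linear Y -> R^o}) : Prop :=
  B `<=` dual_ball /\ forall y : Y, `|y| = sup [set `|f y : R| | f in B].

Definition M4 : set ('I_4 -> Y) :=
  [set y | (forall i, unit_ball (y i)) /\
           (forall i1 i2 i3 : 'I_4, (i1 < i2 < i3)%N ->
              unit_ball (y i1 - y i2 + y i3))].

(* A function on the open interval (0,1) is given by a total function, of
   which only the values on that interval are ever used. *)
Definition below_identity (g : R -> R) : Prop :=
  forall eps : R, 0 < eps < 1 -> 0 < g eps < eps.

Definition AHSp_linf4_with (gamma : R -> R) : Prop :=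
  below_identity gamma /\
  forall eps : R, 0 < eps < 1 -> forall y, M4 y ->
  forall A : {set 'I_4}, A != finset.set0 ->
  (exists2 f, dual_sphere f & forall i, i \in A -> 1 - gamma eps < f (y i)) ->
  exists z, [/\ M4 z,
    forall i, `|z i - y i| < eps &
    `|\sum_(i in A) z i| = #|A|%:R].

Definition AHSp_linf4 : Prop := exists gamma, AHSp_linf4_with gamma.

Definition norming_AHSp_linf4_with (rho : R -> R) : Prop :=
  exists B : set {linear Y -> R^o},
  [/\ B `<=` dual_sphere, one_norming B, below_identity rho &
    forall eps : R, 0 < eps < 1 -> forall y, M4 y ->
    forall A : {set 'I_4}, A != finset.set0 ->
    forall f, B f -> (forall i, i \in A -> 1 - rho eps < f (y i)) ->
    exists z, [/\ M4 z,
      forall i, `|z i - y i| < eps &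
      `|\sum_(i in A) z i| = #|A|%:R]].

Definition convex_AHSp_linf4_at (eps nu : R) : Prop :=
  0 < nu < eps /\
  forall y, M4 y ->
  forall alpha : 'I_4 -> R, (forall i, 0 <= alpha i) -> \sum_i alpha i = 1 ->
  1 - nu < `|\sum_i alpha i *: y i| ->
  exists (A : {set 'I_4}) (z : 'I_4 -> Y), [/\ M4 z,
    1 - eps < \sum_(i in A) alpha i,
    forall i, `|z i - y i| < eps &
    `|\sum_(i in A) z i| = #|A|%:R].

Definition convex_AHSp_linf4_with (nu : R -> R) : Prop :=
  forall eps : R, 0 < eps < 1 -> convex_AHSp_linf4_at eps (nu eps).

End BanachSpace.

(* Main.v *)
(* 2 => 3: a functional f in B that nearly attains the norm of the convex
   combination, up to replacing (y_i) by (-y_i) since B need not be symmetric,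
   exceeds 1 - rho at all the y_i except for a total weight less than rho.
   3 => 1: for the uniform weights on A, the set given by 3 must contain A,
   because each weight is at least 1/4. 1 => 2: take the whole dual sphere for
   B; it is 1-norming by the Hahn-Banach theorem, which is obtained from the
   fact that a minimal sublinear functional is linear. *)
From HB Require Import structures.
From mathcomp Require Import ring lra.
Require Import Defs.

Set Implicit Arguments.
Unset Strict Implicit.
Unset Printing Implicit Defensive.

Local Open Scope classical_set_scope.
Local Open Scope ring_scope.

(** * Hahn-Banach theorem by way of minimal sublinear functionals *)

Section HahnBanach.
Context {R : realType} {V : lmodType R}.
Implicit Types (p q : V -> R) (x y : V).

(** Homogeneity is only an inequality for [c > 0], which is easy to check on infima; applied with
    [c^-1] it yields the reverse inequality. *)
Definition sublinear p : Prop :=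
  (forall x y, p (x + y) <= p x + p y) /\
  (forall (c : R) x, 0 < c -> p (c *: x) <= c * p x).

Lemma sublinear0 p : sublinear p -> p 0 = 0.
Proof.
move=> [padd phom]; apply/eqP; rewrite eq_le.
have := phom 2^-1 0; have := padd 0 0; rewrite scaler0 addr0.
move=> ? /(_ ltac:(lra)) ?; lra.
Qed.

Lemma sublinearN_ge p x : sublinear p -> - p (- x) <= p x.
Proof.
by move=> sp; have := sp.1 x (- x); rewrite subrr (sublinear0 sp); lra.
Qed.

Lemma sublinearZ_ge p (t : R) x : sublinear p -> 0 <= t -> t * p x <= p (t *: x).
Proof.
move=> sp; rewrite le_eqVlt => /predU1P[<-|t0].
  by rewrite scale0r mul0r (sublinear0 sp).
have := sp.2 t^-1 (t *: x); rewrite invr_gt0 => /(_ t0).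
by rewrite scalerA mulVf ?gt_eqF// scale1r ler_pdivlMl.
Qed.

(** The witness [h] may depend on the points because members of [F] need not be sublinear: shifting
    the argument of a sublinear map can destroy subadditivity, while the family of all shifts
    retains it. *)
Lemma sublinear_inf (F : set (V -> R)) : F !=set0 ->
  (forall x, has_lbound [set p x | p in F]) ->
  (forall p q x y, F p -> F q -> exists2 h, F h & h (x + y) <= p x + q y) ->
  (forall p (c : R) x, F p -> 0 < c -> exists2 h, F h & h (c *: x) <= c * p x) ->
  sublinear (fun x => inf [set p x | p in F]).
Proof.
move=> [p0 Fp0] lbF Fadd Fhom.
have ne x : [set p x | p in F] !=set0 by exists (p0 x), p0.
have infF p x : F p -> inf [set p x | p in F] <= p x.
  by move=> Fp; apply: ge_inf => //; exists p.
split=> [x y|c x c0].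
  rewrite -lerBlDr; apply: lb_le_inf => // _ [p Fp <-].
  rewrite lerBlDr -lerBlDl; apply: lb_le_inf => // _ [q Fq <-].
  rewrite lerBlDl; have [h Fh] := Fadd p q x y Fp Fq.
  by apply: le_trans; exact: infF.
rewrite -ler_pdivrMl//; apply: lb_le_inf => // _ [p Fp <-].
rewrite ler_pdivrMl//; have [h Fh] := Fhom p c x Fp c0.
by apply: le_trans; exact: infF.
Qed.

(* The largest candidate that is at most [p] and [- p y] at [- y] is
   [x |-> inf_(t >= 0) (p (x + t y) - t p y)]. *)
Lemma sublinear_descent p y : sublinear p ->
  exists q, [/\ sublinear q, forall x, q x <= p x & q (- y) <= - p y].
Proof.
move=> sp; pose s (t : R) x := p (x + t *: y) - t * p y.
pose F : set (V -> R) := [set s t | t in [set t | 0 <= t]].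
have lbF x : has_lbound [set q x | q in F].
  (* A bound free of [t]: [t * p y <= p (t *: y) <= p (- x) + p (x + t *: y)]. *)
  exists (- p (- x)) => _ [_ [t /= t0 <-] <-]; rewrite /s.
  have := sp.1 (- x) (x + t *: y); rewrite addKr.
  by have := sublinearZ_ge y sp t0; lra.
have infF (t : R) x : 0 <= t -> inf [set q x | q in F] <= s t x.
  by move=> t0; apply: ge_inf => //; exists (s t) => //; exists t.
exists (fun x => inf [set q x | q in F]); split.
- apply: sublinear_inf => //.
  + by exists (s 0), 0 => //=.
  + move=> _ _ x z [t /= t0 <-] [u /= u0 <-].
    exists (s (t + u)); first by exists (t + u) => //=; exact: addr_ge0.
    rewrite /s scalerDl addrACA.
    by have := sp.1 (x + t *: y) (z + u *: y); lra.
  + move=> _ c x [t /= t0 <-] c0.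
    exists (s (c * t)); first by exists (c * t) => //=; rewrite mulr_ge0// ltW.
    rewrite /s -scalerA -scalerDr.
    by have := sp.2 c (x + t *: y) c0; lra.
- by move=> x; have := infF 0 x (lexx _); rewrite /s scale0r addr0 mul0r subr0.
- have := infF 1 (- y) ler01.
  by rewrite /s scale1r addNr (sublinear0 sp) mul1r add0r.
Qed.

(** Zorn's lemma on the sublinear functionals below [p]: the pointwise infimum of a nonempty chain
    is again one of them. *)
Lemma exists_minimal_sublinear p : sublinear p ->
  exists q, [/\ sublinear q, forall x, q x <= p x &
    forall r, sublinear r -> (forall x, r x <= q x) -> forall x, q x <= r x].
Proof.
move=> sp; pose P q := sublinear q /\ forall x, q x <= p x.
pose T := {q | P q}.
have tp : T by exists p; split.
(* The order is reversed, so that a maximal element is pointwise minimal. *)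
pose le (q r : T) := `[< forall x, sval r x <= sval q x >].
have [||A totA|[q [sq qp]] qmin] := @ZL_preorder T tp le.
- by move=> q; apply/asboolP.
- move=> r q u /asboolP rq /asboolP qu; apply/asboolP => x.
  exact: le_trans (qu x) (rq x).
- have [[q0 Aq0]|A0] := pselect (A !=set0); last first.
    by exists tp => q Aq; exfalso; apply: A0; exists q.
  pose F : set (V -> R) := [set sval q | q in A].
  have lbF x : has_lbound [set q x | q in F].
    exists (- p (- x)) => _ [_ [[q [sq qp]] /= Aq <-] <-].
    by apply: le_trans (sublinearN_ge x sq); rewrite lerN2.
  have infF (q : T) x : A q -> inf [set r x | r in F] <= sval q x.
    by move=> Aq; apply: ge_inf => //; exists (sval q) => //; exists q.
  have sF : sublinear (fun x => inf [set r x | r in F]).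
    apply: sublinear_inf => //.
    + by exists (sval q0), q0.
    + move=> _ _ x y [q Aq <-] [r Ar <-].
      (* The smaller of two members of the chain serves at both points. *)
      have [/asboolP qr|/asboolP rq] := totA _ _ Aq Ar.
        exists (sval r); first by exists r.
        by have [[radd _] _] := svalP r; have := radd x y; have := qr x; lra.
      exists (sval q); first by exists q.
      by have [[qadd _] _] := svalP q; have := qadd x y; have := rq y; lra.
    + move=> _ c x [q Aq <-] c0; exists (sval q); first by exists q.
      by have [[_ qhom] _] := svalP q; exact: qhom.
  have Fp x : inf [set r x | r in F] <= p x.
    by apply: le_trans (infF q0 x Aq0) _; have [_] := svalP q0; apply.
  exists (exist P _ (conj sF Fp)) => q Aq; apply/asboolP => x /=.
  exact: infF.
- exists q; split => // r sr rq.
  have rp x : r x <= p x by exact: le_trans (rq x) (qp x).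
  exact: asboolW (qmin (exist P r (conj sr rp)) (asboolT rq)).
Qed.

(** A minimal functional cannot be lowered by [sublinear_descent], so it is odd, and an odd
    sublinear functional is linear. Descending at [y] before minimizing secures the value:
    [f y = - f (- y) >= - q (- y) >= p y]. *)
Lemma linear_below_sublinear p y : sublinear p ->
  exists f : {linear V -> R^o}, (forall x, f x <= p x) /\ f y = p y :> R.
Proof.
move=> sp; have [q [sq qp qy]] := sublinear_descent y sp.
have [f [sf fq fmin]] := exists_minimal_sublinear sq.
have fN x : f (- x) = - f x.
  have [r [sr rf rx]] := sublinear_descent x sf.
  apply/eqP; rewrite eq_le (le_trans (fmin r sr rf _) rx)/=.
  by have := sublinearN_ge x sf; lra.
have fD x z : f (x + z) = f x + f z.
  apply/eqP; rewrite eq_le sf.1/=.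
  by have := sf.1 (x + z) (- z); rewrite addrK fN; lra.
have fZ0 (c : R) x : 0 < c -> f (c *: x) = c * f x.
  by move=> c0; apply/eqP; rewrite eq_le sf.2//= sublinearZ_ge// ltW.
have fZ (c : R) x : f (c *: x) = c * f x.
  have [c0|c0|->] := ltgtP c 0; last by rewrite scale0r mul0r sublinear0.
    by have := fZ0 (- c) x; rewrite oppr_gt0 scaleNr fN mulNr => /(_ c0)/oppr_inj.
  exact: fZ0.
have lf : linear (f : V -> R^o) by move=> c x z; rewrite fD fZ.
pose g : {linear V -> R^o} :=
  HB.pack (f : V -> R^o) (GRing.isLinear.Build _ _ _ _ (f : V -> R^o) lf).
exists g; split=> [x|]; first exact: le_trans (fq x) (qp x).
apply/eqP; rewrite eq_le (le_trans (fq y) (qp y))/=.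
by have := le_trans (fq (- y)) qy; rewrite fN /=; lra.
Qed.

End HahnBanach.

(** * The dual norm, and the dual sphere as a norming set *)

Section DualNorm.
Context {R : realType} {Y : completeNormedModType R}.
Implicit Types (f : {linear Y -> R^o}) (y : Y).

Lemma norming_functional y :
  exists f : {linear Y -> R^o}, (forall x, `|f x : R| <= `|x|) /\ f y = `|y| :> R.
Proof.
have [|f [fle fy]] := @linear_below_sublinear R Y Num.norm y.
  split=> [x z|c x c0]; first exact: ler_normD.
  by rewrite normrZ gtr0_norm.
exists f; split=> // x; rewrite ler_norml fle andbT.
by have := fle (- x); rewrite raddfN normrN /= lerNl.
Qed.

Lemma continuous_contraction f : (forall x, `|f x : R| <= `|x|) -> continuous f.
Proof.
move=> fle; apply/linear_bounded_continuous/linear_boundedP.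
near=> r => x; apply: le_trans (fle x) _.
rewrite ler_peMl//; near: r; exact: nbhs_pinfty_ge.
Unshelve. all: by end_near. Qed.

Lemma dual_norm_set_bounded f :
  continuous f -> has_ubound [set `|f y : R| | y in @unit_ball R Y].
Proof.
move=> /linear_bounded_continuous/linear_boundedP/pinfty_ex_gt0[M M0 fM].
exists M => _ [y /= y1 <-]; apply: le_trans (fM y) _.
by rewrite ger_pMr.
Qed.

Lemma dual_ball_le f y : dual_ball f -> `|f y : R| <= `|y|.
Proof.
move=> [fc f1]; have [->|y0] := eqVneq y 0; first by rewrite raddf0 !normr0.
have ny : 0 < `|y| by rewrite normr_gt0.
have : `|f (`|y|^-1 *: y) : R| <= 1.
  apply: le_trans f1; apply: ub_le_sup; first exact: dual_norm_set_bounded.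
  exists (`|y|^-1 *: y) => //=; rewrite /unit_ball/=.
  by rewrite normrZ normfV normr_id mulVf ?gt_eqF.
rewrite linearZ /= normrM normfV normr_id.
by rewrite ler_pdivrMl// mulr1.
Qed.

Lemma dual_sphere_ball : @dual_sphere R Y `<=` @dual_ball R Y.
Proof. by move=> f [fc f1]; split=> //; rewrite f1. Qed.

Lemma norming_functional_sphere y :
  y != 0 -> exists2 f, dual_sphere f & f y = `|y| :> R.
Proof.
move=> y0; have [f [fle fy]] := norming_functional y.
have ny : 0 < `|y| by rewrite normr_gt0.
have fc := continuous_contraction fle.
exists f => //; split=> //; apply/eqP; rewrite eq_le; apply/andP; split.
  apply: ge_sup; first by exists `|f 0 : R|, 0 => //=; rewrite /unit_ball/= normr0.
  by move=> _ [x /= x1 <-]; exact: le_trans (fle x) x1.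
(* The value 1 is attained at the normalized vector. *)
apply: ub_le_sup; first exact: dual_norm_set_bounded.
exists (`|y|^-1 *: y).
  by rewrite /unit_ball/= normrZ normfV normr_id mulVf ?gt_eqF.
by rewrite linearZ /= fy normrM normfV !normr_id mulVf ?gt_eqF.
Qed.

Lemma one_norming_dual_sphere : one_norming (@dual_sphere R Y).
Proof.
split=> [|y]; first exact: dual_sphere_ball.
(* In the zero space the sphere is empty and the set of values is [set0] instead of [[set 0]]; both
   have [sup] equal to 0. *)
have [->|y0] := eqVneq y 0.
  rewrite normr0; have [[f sf]|s0] := pselect (@dual_sphere R Y !=set0).
    rewrite (_ : [set _ | _ in _] = [set 0]) ?sup1//.
    apply/seteqP; split=> [_ [g sg <-]|_ ->] /=; first by rewrite raddf0 normr0.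
    by exists f => //; rewrite raddf0 normr0.
  rewrite (_ : [set _ | _ in _] = set0) ?sup0//.
  by apply/nonemptyPn => -[_ [f sf _]]; apply: s0; exists f.
have [f sf fy] := norming_functional_sphere y0.
have fb : ubound [set `|f y : R| | f in @dual_sphere R Y] `|y|.
  by move=> _ [g sg <-]; apply: dual_ball_le; exact: dual_sphere_ball.
have fyS : [set `|f y : R| | f in @dual_sphere R Y] `|y|.
  by exists f => //; rewrite fy normr_id.
apply/eqP; rewrite eq_le; apply/andP; split.
  by apply: ub_le_sup => //; exists `|y|.
by apply: ge_sup => //; exists `|y|.
Qed.

End DualNorm.

(** * The three implications *)

Section Equivalence.
Context {R : realType} {Y : completeNormedModType R}.

Lemma M4_opp (y : 'I_4 -> Y) : M4 y -> M4 (fun i => - y i).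
Proof.
move=> [yb yM]; split=> [i|i j k ijk]; rewrite /unit_ball/=.
  by rewrite normrN; exact: yb.
by rewrite -!opprD normrN; exact: yM.
Qed.

Lemma AHSp_norming (gamma : R -> R) :
  AHSp_linf4_with Y gamma -> norming_AHSp_linf4_with Y gamma.
Proof.
move=> [gid H]; exists (@dual_sphere R Y); split=> //.
  exact: one_norming_dual_sphere.
by move=> eps e01 y My A A0 f sf fy; apply: H => //; exists f.
Qed.

(** A Markov-type estimate: each index outside the set costs at least [rho] times its weight, and
    the total loss is below [rho ^+ 2], so the weight outside is below [rho]. This is the origin of
    the square in [nu]. *)
Lemma convex_weight_gt (I : finType) (alpha a : I -> R) (rho : R) :
  0 < rho -> (forall i, 0 <= alpha i) -> \sum_i alpha i = 1 ->
  (forall i, a i <= 1) -> 1 - rho ^+ 2 < \sum_i alpha i * a i ->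
  1 - rho < \sum_(i in [set i | (1 - rho < a i)%R]%SET) alpha i.
Proof.
move=> rho0 al0 al1 a1 hs; set A := [set i | _]%SET.
have : \sum_i alpha i * a i <= \sum_i alpha i * (1 - rho * (i \notin A)%:R).
  apply: ler_sum => i _; apply: ler_wpM2l => //.
  rewrite inE; have [_|] /= := ltP (1 - rho) (a i); first by rewrite mulr0 subr0.
  by rewrite mulr1.
have notA : \sum_i alpha i * (i \notin A)%:R = 1 - \sum_(i in A) alpha i.
  rewrite -[in RHS]al1 [\sum_(i in A) _]big_mkcond -sumrB/=.
  by apply: eq_bigr => i _; case: (i \in A); rewrite ?mulr0 ?mulr1 ?subrr ?subr0.
have -> : \sum_i alpha i * (1 - rho * (i \notin A)%:R) =
    1 - rho * (1 - \sum_(i in A) alpha i).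
  by rewrite -notA -[X in X - _]al1 mulr_sumr -sumrB; apply: eq_bigr => i _; ring.
move=> h; have : rho * (1 - \sum_(i in A) alpha i) < rho * rho.
  by rewrite -expr2; lra.
by rewrite ltr_pM2l//; lra.
Qed.

Lemma norming_convex (rho : R -> R) :
  norming_AHSp_linf4_with Y rho ->
  convex_AHSp_linf4_with Y (fun eps => rho eps ^+ 2).
Proof.
move=> [B [Bs [_ Bn] rid H]] eps e01.
have /andP[r0 re] := rid _ e01; have /andP[e0 e1] := e01.
have r2 : rho eps ^+ 2 < rho eps by rewrite expr2 gtr_pMl//; lra.
split=> [|y My al al0 al1 hs]; first by rewrite exprn_gt0//=; lra.
wlog [f Bf hf] : y My hs / exists2 f, B f & 1 - rho eps ^+ 2 <
    f (\sum_i al i *: y i) :> R => [wl|].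
  move: (hs); rewrite [`|_|]Bn => hs'.
  (* For empty [B] the default [sup set0 = 0] would contradict [1 - rho eps ^+ 2 > 0]. *)
  have Bne : [set `|f (\sum_i al i *: y i) : R| | f in B] !=set0.
    apply: contrapT => /nonemptyPn E; move: hs'; rewrite E sup0; lra.
  have [_ [f Bf <-]] := sup_gt Bne hs'.
  have [f0|f0] := leP 0 (f (\sum_i al i *: y i) : R) => hf.
    by rewrite ger0_norm// in hf; apply: wl => //; exists f.
  rewrite ltr0_norm// in hf.
  have oppS : \sum_i al i *: - y i = - \sum_i al i *: y i.
    by rewrite -sumrN; apply: eq_bigr => i _; rewrite scalerN.
  have [|||A [z [Mz hA zy zA]]] := wl (fun i => - y i).
  - exact: M4_opp.
  - by rewrite oppS normrN.
  - by exists f => //; rewrite oppS raddfN.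
  exists A, (fun i => - z i); split=> //.
  - exact: M4_opp.
  - by move=> i; have := zy i; rewrite opprK -normrN opprD.
  - by rewrite sumrN normrN.
have fb := dual_sphere_ball (Bs _ Bf).
have fy1 i : f (y i) <= 1 :> R.
  apply: le_trans (ler_norm _) (le_trans (dual_ball_le _ fb) _).
  exact: My.1.
have fS : f (\sum_i al i *: y i) = \sum_i al i * f (y i) :> R.
  by rewrite linear_sum; apply: eq_bigr => i _; exact: linearZ.
rewrite fS in hf.
have hA := convex_weight_gt r0 al0 al1 fy1 hf.
set A := [set i | _]%SET in hA.
(* The weight of [A] exceeds [1 - rho eps > 0]. *)
have A0 : A != finset.set0.
  by apply/eqP => AE; move: hA; rewrite AE big_set0; lra.
have [|z [Mz zy zA]] := H eps e01 y My A A0 f Bf.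
  by move=> i; rewrite inE.
by exists A, z; split=> //; lra.
Qed.

(** The part of the sum over [B :\: A] contributes at most its cardinality to the norm, so the part
    over [A] must contribute all of [#|A|]. *)
Lemma norm_sum_card_subset (I : finType) (A B : {set I}) (z : I -> Y) :
  A \subset B -> (forall i, `|z i| <= 1) ->
  `|\sum_(i in B) z i| = #|B|%:R -> `|\sum_(i in A) z i| = #|A|%:R.
Proof.
move=> AB z1 zB.
have le (C : {set I}) : `|\sum_(i in C) z i| <= #|C|%:R.
  apply: le_trans (ler_norm_sum _ _ _) _.
  by rewrite -sum1_card natr_sum; apply: ler_sum => i _; exact: z1.
apply/eqP; rewrite eq_le le/=.
move: zB; rewrite (big_setID A)/= (finset.setIidPr AB) -(cardsID A B) (finset.setIidPr AB).
rewrite natrD => zB; rewrite -(lerD2r #|B :\: A|%:R) -zB.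
by apply: le_trans (ler_normD _ _) _; rewrite lerD2l.
Qed.

Lemma convex_AHSp (nu : R -> R) :
  convex_AHSp_linf4_with Y nu -> AHSp_linf4_with Y (fun eps => nu (eps / 4)).
Proof.
move=> H.
have H4 (eps : R) : 0 < eps < 1 -> convex_AHSp_linf4_at Y (eps / 4) (nu (eps / 4)).
  by move=> /andP[e0 e1]; apply: H; lra.
split=> [eps e01|eps e01 y My A A0 [f sf fy]].
  by have [n01 _] := H4 _ e01; lra.
have [n01 {H4}H4] := H4 _ e01.
have cA : (0 < #|A|)%N by rewrite card_gt0.
have cA0 : 0 < #|A|%:R :> R by rewrite ltr0n.
pose al (i : 'I_4) : R := if i \in A then #|A|%:R^-1 else 0.
have al0 i : 0 <= al i by rewrite /al; case: ifP => // _; rewrite invr_ge0 ltW.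
have alA (a : 'I_4 -> R) :
    \sum_i al i * a i = #|A|%:R^-1 * \sum_(i in A) a i.
  rewrite mulr_sumr [RHS]big_mkcond/=; apply: eq_bigr => i _.
  by rewrite /al; case: ifP => // _; rewrite mul0r.
have al1 : \sum_i al i = 1.
  transitivity (\sum_i al i * 1); first by apply: eq_bigr => i _; rewrite mulr1.
  by rewrite alA sumr_const mulVf// gt_eqF.
have [|A' [z [Mz hA' zy zA']]] := H4 y My al al0 al1.
  (* The norm dominates the value of [f], which is the average over [A] of numbers above
     [1 - nu (eps / 4)]. *)
  apply: lt_le_trans (le_trans (ler_norm _) (dual_ball_le _ (dual_sphere_ball sf))).
  have -> : f (\sum_i al i *: y i) = \sum_i al i * f (y i) :> R.
    by rewrite linear_sum; apply: eq_bigr => i _; exact: linearZ.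
  rewrite alA ltr_pdivlMl// mulr_natl -sumr_const.
  have [i iA] := set0Pn _ A0.
  apply: ltr_sum; last exact: fy.
  by apply/hasP; exists i => //; rewrite mem_index_enum.
(* The source of the factor 4: each weight on [A] exceeds the tolerance [eps / 4]. *)
have cA4 : 4^-1 <= #|A|%:R^-1 :> R.
  rewrite lef_pV2 ?posrE// ler_nat.
  by have := max_card (mem A); rewrite card_ord.
exists z; split=> //.
  by move=> i; apply: lt_trans (zy i) _; lra.
apply: norm_sum_card_subset zA'; last exact: Mz.1.
(* A missing index would cost [A'] a weight of at least [1 / 4]. *)
apply/fintype.subsetP => i iA; apply: contraT => iA'.
have : \sum_(j in A') al j + al i <= 1.
  rewrite -al1 (bigID (mem A') xpredT)/= lerD2l (bigD1 i)//= lerDl.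
  exact: sumr_ge0.
by rewrite /al iA -/al; lra.
Qed.

Lemma convex_choice :
  (forall eps : R, 0 < eps < 1 -> exists nu, convex_AHSp_linf4_at Y eps nu) ->
  exists nu, convex_AHSp_linf4_with Y nu.
Proof.
move=> H.
have [|nu nuP] := @choice R R (fun eps nu => 0 < eps < 1 ->
    convex_AHSp_linf4_at Y eps nu).
  move=> eps; have [e01|ne01] := pselect (0 < eps < 1 : Prop).
    by have [nu ?] := H _ e01; exists nu.
  (* Outside the interval any value will do. *)
  by exists 0.
by exists nu.
Qed.

End Equivalence.

Theorem proposition2p12 (R : realType) (Y : completeNormedModType R) :
  [/\ AHSp_linf4 Y <-> (exists rho : R -> R, norming_AHSp_linf4_with Y rho),
      (exists rho : R -> R, norming_AHSp_linf4_with Y rho) <->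
        (forall eps : R, 0 < eps < 1 ->
           exists nu : R, convex_AHSp_linf4_at Y eps nu),
      (forall rho : R -> R, norming_AHSp_linf4_with Y rho ->
         convex_AHSp_linf4_with Y (fun eps => rho eps ^+ 2)) &
      (forall nu : R -> R, convex_AHSp_linf4_with Y nu ->
         AHSp_linf4_with Y (fun eps => nu (eps / 4)))].
Proof.
split.
- split=> [[gamma /AHSp_norming]|[rho /norming_convex/convex_AHSp ?]].
    by exists gamma.
  by eexists; eassumption.
- split=> [[rho /norming_convex H] eps e01|].
    by exists (rho eps ^+ 2); exact: H.
  by move=> /convex_choice[nu /convex_AHSp/AHSp_norming ?]; eexists; eassumption.
- exact: norming_convex.
- exact: convex_AHSp.
Qed.
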